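(* Let $\mathcal{H}$ be a Hilbert space, $V$ a Banach space, $A\in\mathcal{L}(\mathcal{H},V)$ a linear and continuous operator, and $A^*\in\mathcal{L}(V',\mathcal{H})$ its adjoint. Assume that for an orthogonal projection $P\colon\mathcal{H}\to\mathcal{H}$ there exists a constant $\varepsilon>0$ such that $$\|A(f-Pf)\|_V\le \varepsilon\,\|f\|_{\mathcal{H}}\qquad\text{for all } f\in\mathcal{H}.$$ Then for every $v\in A^*(V')$, $$\|v-Pv\|_{\mathcal{H}}\le \varepsilon\,\|v\|_{A^*(V')},$$ where $\|v\|_{A^*(V')}:=\inf\{\|g\|_{V'} : g\in V',\ v=A^*g\}$.
   Context: $\mathcal{L}(V,W)$ denotes the space of bounded linear operators between Banach spaces $V$ and $W$; $V'$ is the (continuous) dual of $V$. All spaces are over $\mathbb{R}$. The adjoint $A^*\colon V'\to\mathcal{H}$ of $A\in\mathcal{L}(\mathcal{H},V)$ is defined by $\langle A^*g,f\rangle_{\mathcal{H}}=g(Af)$ for all $f\in\mathcal{H}$, $g\in V'$ (the dual of $\mathcal{H}$ being identified with $\mathcal{H}$ via the Riesz theorem). *)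

(* Defs.v *)
From HB Require Import structures.
From mathcomp Require Import all_boot all_order all_algebra.
From mathcomp Require Import all_classical all_reals interval_inference
  topology normedtype sequences.
From mathcomp Require Import ring lra.

Set Implicit Arguments.
Unset Strict Implicit.
Unset Printing Implicit Defensive.

Import Order.TTheory GRing.Theory Num.Theory numFieldNormedType.Exports.

Local Open Scope classical_set_scope.
Local Open Scope ring_scope.

(* Real Hilbert spaces: Banach spaces whose norm comes from an inner product.
   [{dot H for idfun}] is MathComp's type of symmetric, positive definite
   bilinear forms on [H]. *)
HB.mixin Record CompleteNormedModule_isHilbert (R : realType) H
    of CompleteNormedModule R H := {
  inner : {dot H for idfun};
  sqr_norm_inner : forall x : H, `|x| ^+ 2 = inner x x
}.

#[short(type="hilbertType")]
HB.structure Definition Hilbert (R : realType) :=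
  {H of CompleteNormedModule R H & CompleteNormedModule_isHilbert R H}.

HB.structure Definition BoundedOp (R : realType) (V W : normedModType R) :=
  {f of @GRing.Linear R V W *:%R f & @isContinuous V W f}.

(* For linear maps between normed spaces, bounded means continuous
   (linear_bounded_continuous). *)
Notation "''L' ( V , W )" := (@BoundedOp.type _ V W)
  (at level 8, format "''L' ( V ,  W )") : type_scope.

Definition dual (R : realType) (V : normedModType R) : Type := 'L(V, R^o).

Definition opnorm (R : realType) (V W : normedModType R) (T : 'L(V, W)) : R :=
  sup [set `|T x| | x in [set x : V | `|x| <= 1]].

(* Idempotent and self-adjoint; such an operator is automatically bounded, with
   closed range. *)
Definition orthogonal_projection (R : realType) (H : hilbertType R)
    (P : {linear H -> H}) : Prop :=
  (forall f, P (P f) = P f) /\ (forall f g, inner (P f) g = inner f (P g)).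

Section Riesz.
Context (R : realType) (H : hilbertType R) (g : dual H).

Let ip (x y : H) : R := inner x y.

Let ipC x y : ip x y = ip y x.
Proof. by rewrite /ip (@hermitian_subproof _ _ _ _ inner x y) expr0 mul1r. Qed.

Let ipDl x y z : ip (x + y) z = ip x z + ip y z.
Proof. by rewrite /ip linearDl. Qed.

Let ipZl a x z : ip (a *: x) z = a * ip x z.
Proof. by rewrite /ip linearZl_LR. Qed.

Let ipDr x y z : ip z (x + y) = ip z x + ip z y.
Proof. by rewrite ![ip z _]ipC ipDl. Qed.

Let ipZr a x z : ip z (a *: x) = a * ip z x.
Proof. by rewrite ![ip z _]ipC ipZl. Qed.

Let gD x y : (g (x + y) : R) = g x + g y.
Proof. exact: linearD. Qed.

Let gZ a x : (g (a *: x) : R) = a * g x.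
Proof. exact: linearZ. Qed.

Let J (x : H) : R := `|x| ^+ 2 - 2 * g x.

Let J_lb : has_lbound (range J).
Proof.
have /linear_boundedP : bounded_near g (nbhs (0 : H)).
  exact/linear_bounded_continuous/cts_fun.
move=> /pinfty_ex_gt0 [M M0 gM].
exists (- M ^+ 2) => _ [x _ <-]; rewrite /J.
have /ler_normlP[_ gx] := gM x.
have : 0 <= (`|x| - M) ^+ 2 by exact: sqr_ge0.
move: gx; set a : R := g x; set n := `|x|; nra.
Qed.

Let m := inf (range J).

Let mJ x : m <= J x.
Proof. by apply: ge_inf J_lb _ _; exists x. Qed.

Let J_sub x y : `|x - y| ^+ 2 <= 2 * (J x + J y - 2 * m).
Proof.
have := mJ (2^-1 *: (x + y)).
rewrite /J -(scaleN1r y) !sqr_norm_inner -!/(ip _ _).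
rewrite !(ipDl, ipDr, ipZl, ipZr, gZ, gD) (ipC y x).
set a : R := g x; set b : R := g y. lra.
Qed.

Lemma riesz : exists h : H, forall f : H, inner h f = g f.
Proof.
have hinf : has_inf (range J) by split; [exists (J 0), 0 | exact: J_lb].
have /choice[u uP] : forall n : nat, exists x, J x < m + n.+1%:R^-1.
  move=> n.
  have n0 : 0 < n.+1%:R^-1 :> R by rewrite invr_gt0.
  by have [_ [x _ <-] xm] := inf_adherent n0 hinf; exists x.
have cu : cvgn u.
  apply/cauchy_cvgP/cauchy_ballP => e e0.
  have e4 : 0 < e ^+ 2 / 4 by rewrite divr_gt0// exprn_gt0.
  have [N _ NP] : \forall n \near \oo, n.+1%:R^-1 < e ^+ 2 / 4 :> R.
    by apply: (near_infty_natSinv_lt (PosNum e4)).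
  exists (u @` [set n | (N <= n)%N], u @` [set n | (N <= n)%N]) => /=.
    by split; exists N => // n Nn; exists n.
  move=> [_ _] /= [[i Ni <-] [j Nj <-]]; rewrite -ball_normE /=.
  rewrite -(@ltr_pXn2r _ 2)// ?nnegrE ?normr_ge0 ?(ltW e0)//.
  apply: le_lt_trans (J_sub _ _) _.
  have /= := uP i; have /= := uP j; have /= := NP i Ni; have /= := NP j Nj.
  set a := i.+1%:R^-1; set b := j.+1%:R^-1. lra.
pose h := lim (u @ \oo).
have Ju : J (u n) @[n --> \oo] --> J h.
  apply: cvgB.
    rewrite expr2; under eq_fun do rewrite expr2.
    by apply: cvgM; apply: cvg_norm.
  apply: cvgMr.
  by apply: continuous_cvg => //; exact: cts_fun.
have Jh : J h <= m.
  apply/ler_addgt0Pr => e e0; rewrite -(cvg_lim _ Ju)//.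
  apply: limr_le; first by apply/cvg_ex; exists (J h).
  have := near_infty_natSinv_lt (PosNum e0); apply: filterS => n /= ne.
  by rewrite (le_trans (ltW (uP n)))// lerD2l ltW.
exists h => f; rewrite -/(ip h f).
have Q t : 0 <= t ^+ 2 * ip f f + 2 * t * (ip h f - g f).
  have := le_trans Jh (mJ (h + t *: f)).
  rewrite /J !sqr_norm_inner -!/(ip _ _).
  rewrite !(ipDl, ipDr, ipZl, ipZr, gZ, gD) (ipC f h).
  set a : R := g h; set b : R := g f; nra.
apply/eqP; rewrite -subr_eq0; apply/eqP.
move: Q; set d := ip h f - g f; set c := ip f f => Q.
have c0 : 0 <= c by rewrite /c /ip -sqr_norm_inner sqr_ge0.
have := Q (- d / (c + 1)).
have c1 : c + 1 != 0 by rewrite gt_eqF// ltr_wpDl.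
have -> : (- d / (c + 1)) ^+ 2 * c + 2 * (- d / (c + 1)) * d =
  - (d / (c + 1)) ^+ 2 * (c + 2) by field.
rewrite mulNr oppr_ge0 => le0.
have /eqP : (d / (c + 1)) ^+ 2 = 0.
  have := sqr_ge0 (d / (c + 1)); nra.
by rewrite sqrf_eq0 mulf_eq0 invr_eq0 (negbTE c1) orbF => /eqP.
Qed.

End Riesz.

Section Adjoint.
Context (R : realType) (H : hilbertType R) (V : normedModType R).
Variable A : 'L(H, V).

Lemma adjoint_exists (g : dual V) :
  exists h : H, forall f : H, inner h f = g (A f).
Proof.
have gA_cts : continuous (g \o A : H -> R^o).
  by move=> x; apply: continuous_comp; exact: cts_fun.
have gA_lin : linear (g \o A : H -> R^o).
  by move=> a x y /=; rewrite !linearP.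
pose gA : dual H := HB.pack (g \o A : H -> R^o)
  (GRing.isLinear.Build _ _ _ _ (g \o A : H -> R^o) gA_lin)
  (isContinuous.Build _ _ (g \o A : H -> R^o) gA_cts).
exact: (riesz gA).
Qed.

(* A^* g is the unique h in H with <h, f> = g (A f) for all f; it exists by the
   Riesz theorem. *)
Definition adjoint (g : dual V) : H := sval (cid (adjoint_exists g)).

Lemma adjointE (g : dual V) (f : H) : inner (adjoint g) f = g (A f).
Proof. exact: (svalP (cid (adjoint_exists g))). Qed.

Definition range_norm (v : H) : R :=
  inf [set opnorm g | g in [set g : dual V | v = adjoint g]].

End Adjoint.

(* Main.v *)
(* For v = A^* g, self-adjointness and idempotence of P give, with w = v - P v,
   |w|^2 = <v, w - P w> = g (A (w - P w)) <= |g| eps |w|.  Hence |w| / eps is a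
   lower bound of the norms of all g with v = A^* g. *)
Require Import Defs.
From mathcomp Require Import all_boot all_order all_algebra.
From mathcomp Require Import all_classical all_reals topology normedtype.

Import Order.TTheory GRing.Theory Num.Theory.
Import numFieldNormedType.Exports.

Local Open Scope classical_set_scope.
Local Open Scope ring_scope.

(** A continuous linear map satisfies a bound [M * |x|], hence is bounded by [M] on the unit ball.
    This makes the [sup] in [opnorm] a genuine least upper bound instead of a default value. *)
Lemma has_sup_opnorm (R : realType) (V W : normedModType R) (T : 'L(V, W)) :
  has_sup [set `|T x| | x in [set x : V | `|x| <= 1]].
Proof.
split; first by exists `|T 0|, 0 => //=; rewrite normr0.
have /linear_boundedP : bounded_near T (nbhs (0 : V)).
  exact/linear_bounded_continuous/cts_fun.
move=> /pinfty_ex_gt0 [M M0 TM].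
exists M => _ [x /= x1 <-].
by rewrite (le_trans (TM x))// ler_piMr// ltW.
Qed.

(** By homogeneity it suffices to test the unit vector in the direction of [x], available once [x]
    is nonzero. *)
Lemma le_opnorm (R : realType) (V W : normedModType R) (T : 'L(V, W)) (x : V) :
  `|T x| <= opnorm T * `|x|.
Proof.
have [->|x0] := eqVneq x 0; first by rewrite linear0 !normr0 mulr0.
have nx : 0 < `|x| by rewrite normr_gt0.
rewrite -ler_pdivrMr//.
apply: sup_upper_bound (has_sup_opnorm _ _ _ T) _ _.
exists (`|x|^-1 *: x) => /=.
  by rewrite normrZ normfV normr_id mulVf// gt_eqF.
by rewrite linearZ normrZ normfV normr_id mulrC.
Qed.

(** The residual [v - P v] is killed by [P], hence orthogonal to [P v]. The vanishing term
    [P (v - P v)] is kept so that a bound on [A (f - P f)] can be applied with f the residual. *)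
Lemma sqr_norm_sub_projection (R : realType) (H : hilbertType R)
    (P : {linear H -> H}) (v : H) :
  orthogonal_projection P ->
  `|v - P v| ^+ 2 = inner v ((v - P v) - P (v - P v)).
Proof.
move=> [PP PC].
have Pw : P (v - P v) = 0 by rewrite linearB /= PP subrr.
have vw : inner (P v) (v - P v) = 0 by rewrite PC Pw linear0r.
by rewrite Pw subr0 sqr_norm_inner linearBl /= vw subr0.
Qed.

Lemma opnorm_ge0 (R : realType) (V W : normedModType R) (T : 'L(V, W)) :
  0 <= opnorm T.
Proof.
apply: le_trans (normr_ge0 (T 0)) _.
apply: sup_upper_bound (has_sup_opnorm _ _ _ T) _ _.
by exists 0; rewrite /= ?normr0.
Qed.

Lemma norm_sub_projection_adjoint (R : realType) (H : hilbertType R)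
    (V : normedModType R) (A : 'L(H, V)) (P : {linear H -> H}) (eps : R)
    (g : dual V) :
  orthogonal_projection P ->
  0 <= eps ->
  (forall f : H, `|A (f - P f)| <= eps * `|f|) ->
  `|adjoint A g - P (adjoint A g)| <= eps * opnorm g.
Proof.
move=> orthP eps0 Aeps.
have := sqr_norm_sub_projection _ _ P (adjoint A g) orthP.
set w := adjoint A g - _; rewrite adjointE => w2.
(* One factor |w| is cancelled below, so w = 0 is settled first. *)
have [->|w0] := eqVneq w 0; first by rewrite normr0 mulr_ge0 ?opnorm_ge0.
have nw : 0 < `|w| by rewrite normr_gt0.
rewrite -(ler_pM2r nw) -expr2 w2 (le_trans (ler_norm _))//.
apply: le_trans (le_opnorm _ _ _ g (A (w - P w))) _.
(* Once [opnorm g] is factored out, what remains is [Aeps] at [w]. *)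
by rewrite mulrAC [leRHS]mulrC ler_wpM2l ?opnorm_ge0.
Qed.

Theorem theorem6 (R : realType) (H : hilbertType R)
    (V : completeNormedModType R) (A : 'L(H, V)) (P : {linear H -> H})
    (eps : R) :
  orthogonal_projection P ->
  0 < eps ->
  (forall f : H, `|A (f - P f)| <= eps * `|f|) ->
  forall v : H, range (adjoint A) v ->
    `|v - P v| <= eps * range_norm A v.
Proof.
move=> orthP eps0 Aeps v [g0 _ g0v].
(* A lower bound lies below the infimum only of a nonempty set; the preimage [g0] of [v] provides an
   element. *)
rewrite -ler_pdivrMl//; apply: lb_le_inf; first by exists (opnorm g0), g0.
move=> _ [g /= -> <-]; rewrite ler_pdivrMl//.
by apply: norm_sub_projection_adjoint => //; exact: ltW.
Qed.
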